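(* (a) For any integer $m\ge 1$, let $\alpha_1,\ldots,\alpha_m\in\mathbb{C}$ be the zeroes of the polynomial $E_m(x):=\sum_{k=0}^m \frac{x^k}{k!}$. If $\pi\in\mathfrak{S}_{m,n}$ is chosen uniformly at random, then the limit $\mathcal{L}_m^1:=\lim_{n\to\infty}\mathbb{E}[L^1_{m,n}(\pi)]$ exists and $$\mathcal{L}_m^1=-1-\sum_{i=1}^m \alpha_i^{-1}e^{-\alpha_i}.$$ (b) There exist absolute constants $\beta>0$ and $K>0$ such that for all integers $m\ge 1$, $$\left|\mathcal{L}_m^1-\left(m+1-\frac{1}{m+2}\right)\right|\le K e^{-\beta m}.$$
   Context: For positive integers $m,n$, $\mathfrak{S}_{m,n}$ is the set of words $\pi$ of length $mn$ which use each integer in $[n]=\{1,\ldots,n\}$ exactly $m$ times. For $\pi\in\mathfrak{S}_{m,n}$, $L^1_{m,n}(\pi)$ is the length of the longest (not necessarily contiguous) subsequence of $\pi$ of the form $1\,2\,3\cdots j$. *)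

(* Defs.v *)
From HB Require Import structures.
From mathcomp Require Import all_boot all_order all_algebra.
From mathcomp Require Import complex.
From mathcomp Require Import all_classical all_reals all_analysis.

Set Implicit Arguments.
Unset Strict Implicit.
Unset Printing Implicit Defensive.

Import Order.TTheory GRing.Theory Num.Theory.
Import numFieldNormedType.Exports.

Local Open Scope ring_scope.
Local Open Scope complex_scope.
Local Open Scope classical_set_scope.

(* A letter i : 'I_n stands for the integer i.+1 of [n] = {1, ..., n}. *)
Definition multiperm (m n : nat) : {set (m * n).-tuple 'I_n} :=
  [set w : (m * n).-tuple 'I_n | [forall i : 'I_n, count_mem i w == m]]%SET.

Definition letters (m n : nat) (w : (m * n).-tuple 'I_n) : seq nat :=
  [seq (nat_of_ord i).+1 | i <- w].

(* A subsequence 1 2 ... j of w uses j distinct letters, so that j <= n and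
   the bound on j in the maximum excludes nothing. *)
Definition L1 (m n : nat) (w : (m * n).-tuple 'I_n) : nat :=
  (\max_(j < n.+1 | subseq (iota 1 j) (letters w)) j)%N.

Definition meanL1 (R : realType) (m n : nat) : R :=
  (\sum_(w in multiperm m n) (L1 w)%:R) / #|multiperm m n|%:R.

Definition limL1 (R : realType) (m : nat) : R := limn (meanL1 R m).

Definition truncexp (R : realType) (m : nat) : {poly R[i]} :=
  \poly_(k < m.+1) (k`!%:R)^-1.

(* Euler's formula: e^(x+iy) = e^x (cos y + i sin y). *)
Definition expC (R : realType) (z : R[i]) : R[i] :=
  let: x +i* y := z in (expR x * cos y) +i* (expR x * sin y).

(* The entries of a are the zeroes of p, listed with multiplicity. *)
Definition zeroes_of (R : realType) (p : {poly R[i]}) (m : nat)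
    (a : m.-tuple R[i]) : Prop :=
  p = lead_coef p *: \prod_(i < m) ('X - (tnth a i)%:P).

(* Main.v *)
Require Import Defs.
From HB Require Import structures.
From mathcomp Require Import all_boot all_order all_algebra.
From mathcomp Require Import complex.
From mathcomp Require Import all_classical all_reals all_analysis.
From mathcomp Require Import ring lra polyrcf.
Import Order.TTheory GRing.Theory Num.Theory.
Import numFieldNormedType.Exports.
Local Open Scope ring_scope.
Local Open Scope complex_scope.
Local Open Scope classical_set_scope.

Set Implicit Arguments.
Unset Strict Implicit.
Unset Printing Implicit Defensive.

(** Let the m copies of each letter arrive at independent uniform times in
  [0, 1], and read greedily: wait for a first 1, then for a 2, and so on.
  Each wait is the minimum of m fresh uniform variables, so 1 2 .. j is a
  subsequence with the probability that j independent waits of density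
  m (1 - u)^(m-1) add up to at most 1, and the limit of the means is the
  renewal function of this density at time 1.

  Only polynomials are used.  The map [borel], z^k |-> t^k / k!, takes
  z p q to the convolution of the images of p and q, and takes
  [misspoly c] = sum_k c (c-1) .. (c-k+1) (-z)^k to (1 - t)^c.  Hence the
  density above is the image of (1 - misspoly m) / z, and the renewal
  function is the image of the series sum_j (1 - misspoly m)^j, the inverse
  of [misspoly m].  The probabilistic reading is replaced by [count_words],
  an induction on the first letter of the word in which the sum over that
  letter acts as the derivation z d/dz.

  Limit.  Reversing the coefficients of E_m gives
  misspoly m = prod_i (1 + alpha_i z).  From the two identities
  m misspoly m - z (misspoly m)' = m misspoly (m-1) and
  m z misspoly (m-1) = 1 - misspoly m, the logarithmic derivative of the
  product gives 1 / misspoly m = 1 + z sum_i 1 / (1 + alpha_i z).  The image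
  of this at 1 is 1 + sum_i (1 - e^(-alpha_i)) / alpha_i, and
  sum_i 1 / alpha_i = -1 because E_m(0) = E_m'(0).  Exchanging the two
  summations is legitimate because (1 - misspoly m)^j is divisible by z^j,
  so that its image has coefficients of total size at most C^j / j!.

  Remainder.  Let r be the difference between the renewal function and the
  line (m+1) t + (m+1)/(m+2).  The density f is close to m e^(-mu), whose
  renewal equation is inverted by 1 + m z; multiplying the renewal equation
  by 1 + m z replaces f by the kernel k(u) = m u (1 - u)^(m-1), of mass only
  1/(m+1), and turns the equation into r = g + k * r with
  |g(t)| <= 2 (1 - t)^m.  Convolution by k maps (1 - t/10)^m to at most 3/4
  of itself ([kernel_decay]), so |r(t)| <= 8 (1 - t/10)^m.  At t = 1 this is
  the claim with K = 8 and beta = 1/10.  Positivity of convolutions on [0, 1]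
  follows from the mean value theorem for polynomials. *)

(** * The Borel transform *)

Section FormalPolynomials.
Variable K : numFieldType.
Implicit Types (p q : {poly K}) (c k : nat) (t : K).

Lemma fact_natr_neq0 k : k`!%:R != 0 :> K.
Proof. by rewrite pnatr_eq0 -lt0n fact_gt0. Qed.

(** The image of this polynomial under [borel] is (1 - t)^c, the probability
  that c independent uniform times all miss [0, t]. *)
Definition misspoly c : {poly K} := \poly_(k < c.+1) ((-1) ^+ k * (c ^_ k)%:R).

Lemma coef_misspoly c k : (misspoly c)`_k = (-1) ^+ k * (c ^_ k)%:R.
Proof.
rewrite coef_poly ltnS; case: leqP => // ck.
by rewrite ffact_small // mulr0.
Qed.

Lemma misspoly0 : misspoly 0 = 1.
Proof.
apply/polyP => -[|k]; rewrite coef_misspoly coef1 ?mulr1 //.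
by rewrite ffact0n mulr0.
Qed.

Lemma mulX_misspoly c : c.+1%:R *: ('X * misspoly c) = 1 - misspoly c.+1.
Proof.
apply/polyP => -[|k].
  by rewrite coefZ coefXM coefB coef1 !coef_misspoly eqxx mulr0 mulr1 subrr.
rewrite coefZ coefXM coefB coef1 !coef_misspoly /= sub0r ffactSS natrM exprS.
ring.
Qed.

(** The Euler operator z d/dz lowers the index of [misspoly], just as removing
  one of the c copies of a letter does. *)
Lemma mulX_deriv_misspoly c :
  'X * deriv (misspoly c) = c%:R *: (misspoly c - misspoly c.-1).
Proof.
apply/polyP => -[|k]; rewrite coefXM coefZ coefB !coef_misspoly /=.
  by rewrite subrr mulr0.
rewrite coef_deriv coef_misspoly; case: c => [|c].
  by rewrite ffact0n mulr0 mul0rn mul0r.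
rewrite ffactSS ffactnSr -!mulrnAl -mulr_natr /=.
have [le_kc|lt_ck] := leqP k c;
  last by rewrite ffact_small // mul0n muln0 !(mulr0, mul0r, subrr).
rewrite !natrM natrB // -!natr1 exprS; ring.
Qed.

Definition borel p : {poly K} := \poly_(k < size p) (p`_k / k`!%:R).

Lemma coef_borel p k : (borel p)`_k = p`_k / k`!%:R.
Proof.
rewrite coef_poly; case: ltnP => // le_pk.
by rewrite nth_default // mul0r.
Qed.

Fact borel_is_linear : linear borel.
Proof.
by move=> a p q; apply/polyP => k; rewrite !(coef_borel, coefD, coefZ) mulrDl mulrA.
Qed.
HB.instance Definition _ :=
  GRing.isLinear.Build K {poly K} {poly K} _ borel borel_is_linear.

Lemma borelC (a : K) : borel a%:P = a%:P.
Proof.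
by apply/polyP => -[|k]; rewrite coef_borel coefC ?divr1 ?mul0r.
Qed.

Lemma borelX : borel 'X = 'X.
Proof.
apply/polyP => k; rewrite coef_borel coefX.
by case: eqP => [->|_]; rewrite ?divr1 ?mul0r.
Qed.

Lemma borel_misspoly c : borel (misspoly c) = (1 - 'X) ^+ c.
Proof.
apply/polyP => k; rewrite coef_borel coef_misspoly exprBn coef_sum.
under eq_bigr => i _.
  rewrite expr1n mulr1 -polyC1 -polyCN -polyC_exp coefMn coefCM coefXn.
  over.
have [lt_kc|lt_ck] := ltnP k c.+1; last first.
  rewrite ffact_small // mulr0 mul0r big1 // => i _.
  by rewrite gtn_eqF ?mulr0 ?mul0rn // (leq_trans _ lt_ck).
rewrite (bigD1 (Ordinal lt_kc)) //= big1 => [|i ne_ik].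
  by rewrite addr0 eqxx mulr1 -bin_ffact natrM mulrA mulfK ?fact_natr_neq0 // mulr_natr.
have /negPf -> : k != i by apply: contraNneq ne_ik => ki; apply/eqP/val_inj.
by rewrite mulr0 mul0rn.
Qed.

Lemma deriv_borelXM q : deriv (borel ('X * q)) = borel q.
Proof.
apply/polyP => k; rewrite coef_deriv !coef_borel coefXM /=.
by rewrite factS natrM invfM -[LHS]mulr_natr -!mulrA [_^-1 * _%:R]mulrC mulKf //.
Qed.

Lemma borelXM0 q : (borel ('X * q)).[0] = 0.
Proof. by rewrite horner_coef0 coef_borel coefXM mul0r. Qed.

Lemma borel_mulX_deriv p : borel ('X * deriv p) = 'X * deriv (borel p).
Proof.
apply/polyP => -[|k]; rewrite !(coef_borel, coefXM) ?mul0r //=.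
by rewrite !coef_deriv coef_borel mulrnAl.
Qed.

Definition borel_at1 p : K := (borel p).[1].

Fact borel_at1_is_linear : scalar borel_at1.
Proof. by move=> a p q; rewrite /borel_at1 linearP hornerD hornerZ. Qed.
HB.instance Definition _ :=
  GRing.isLinear.Build K {poly K} K _ borel_at1 borel_at1_is_linear.

Lemma borel_at1_1 : borel_at1 1 = 1.
Proof. by rewrite /borel_at1 borelC hornerC. Qed.

(** The Euler operator commutes with [borel], and differentiating undoes the
  factor z; this is how the length of a word enters the first-letter
  induction. *)
Lemma borel_at1_mulX_deriv q : borel_at1 ('X * deriv ('X * q)) = borel_at1 q.
Proof.
by rewrite /borel_at1 borel_mulX_deriv deriv_borelXM hornerM hornerX mul1r.
Qed.

End FormalPolynomials.

(** * Counting words with a given content *)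

Section Words.
Variables (K : numFieldType) (T : finType).
Implicit Types (c : T -> nat) (s : seq T).

Definition has_content c (w : seq T) := [forall x, count_mem x w == c x].

Definition remove_letter c x : T -> nat := fun y => (c y - (y == x))%N.

Lemma sum_tuple_cons N (P : pred (seq T)) (F : seq T -> K) :
  \sum_(w : N.+1.-tuple T | P w) F w =
  \sum_x \sum_(w : N.-tuple T | P (x :: w)) F (x :: w).
Proof.
rewrite (reindex (fun u : T * N.-tuple T => [tuple of u.1 :: u.2])) /=; last first.
  exists (fun w : N.+1.-tuple T => (thead w, [tuple of behead w])) => [[x w] _|w _] /=.
    by rewrite theadE; congr pair; apply: val_inj.
  by rewrite -tuple_eta.
by rewrite pair_big_dep.
Qed.

Lemma has_content_cons c x (w : seq T) :
  has_content c (x :: w) = (0 < c x)%N && has_content (remove_letter c x) w.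
Proof.
apply/forallP/andP => [cxw|[cx_gt0 /forallP cw] y].
  split; first by have /eqP <- := cxw x; rewrite /= eqxx.
  apply/forallP => y; rewrite /remove_letter; have /eqP <- := cxw y.
  by rewrite /= [x == y]eq_sym addKn.
have /eqP cwy := cw y; rewrite /= cwy /remove_letter [x == y]eq_sym.
by have [->|_] := eqVneq y x; rewrite ?subn0 // subnKC.
Qed.

Lemma sum_remove_letter c N x :
  (\sum_y c y = N.+1)%N -> (0 < c x)%N -> (\sum_y remove_letter c x y = N)%N.
Proof.
move=> cN cx; rewrite (bigD1 x) //= /remove_letter eqxx subn1.
under eq_bigr => y /negPf -> do rewrite subn0.
by apply: succn_inj; rewrite -cN [in RHS](bigD1 x) //= -addSn prednK.
Qed.

Lemma prod_fact_remove_letter c x :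
  (0 < c x)%N -> (\prod_y (c y)`! = c x * \prod_y (remove_letter c x y)`!)%N.
Proof.
move=> cx; rewrite (bigD1 x) //= [in RHS](bigD1 x) //= /remove_letter eqxx subn1.
under [in RHS]eq_bigr => y /negPf -> do rewrite subn0.
by rewrite mulnA -{1 2}(prednK cx) -factS.
Qed.

Let hit c x : {poly K} := 1 - misspoly K (c x).

(** Choosing the first letter x with weight c x and removing it acts on the
  factor of x as c x - z d/dz.  As the letters of s are distinct, the sum
  over x is the number of letters minus z d/dz on the whole product, by the
  Leibniz rule. *)
Lemma sum_remove_letter_prod c s : uniq s ->
  \sum_x (c x)%:R *: \prod_(y <- s) hit (remove_letter c x) y =
  (\sum_x c x)%:R *: \prod_(y <- s) hit c y - 'X * deriv (\prod_(y <- s) hit c y).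
Proof.
elim: s => [_|i s IHs /= /andP[s'i us]].
  rewrite big_nil derivC mulr0 subr0 natr_sum scaler_suml.
  by apply: eq_bigr => x _; rewrite big_nil.
have prod_i : \prod_(y <- s) hit (remove_letter c i) y = \prod_(y <- s) hit c y.
  apply: eq_big_seq => y sy; rewrite /hit /remove_letter.
  by case: eqP sy s'i => [-> ->|_ _ _] //=; rewrite subn0.
have := IHs us; rewrite (bigD1 i) //= prod_i => /(canRL (addKr _)) sum_s.
rewrite (bigD1 i) //=.
have -> : \sum_(x | x != i) (c x)%:R *: \prod_(y <- i :: s) hit (remove_letter c x) y =
    hit c i * \sum_(x | x != i) (c x)%:R *: \prod_(y <- s) hit (remove_letter c x) y.
  rewrite mulr_sumr; apply: eq_bigr => x /negPf ne_xi.
  by rewrite big_cons {1}/hit {1}/remove_letter eq_sym ne_xi subn0 scalerAr.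
rewrite sum_s !big_cons prod_i derivM.
rewrite /hit {1}/remove_letter eqxx subn1 derivB derivC sub0r.
have := mulX_deriv_misspoly K (c i).
set B := misspoly K (c i); set B' := misspoly K _; set P := \prod_(_ <- _) _.
set N := (\sum_x c x)%N => XB.
apply/eqP; rewrite -subr_eq0 -!mul_polyC; apply/eqP.
transitivity (P * ((c i)%:R%:P * (B - B') - 'X * deriv B)); first ring.
by rewrite XB -mul_polyC subrr mulr0.
Qed.

(** Induction on the first letter of the word: the pattern s loses its head i
  if that letter is i, and is unchanged otherwise.
  [sum_remove_letter_prod] computes the sum as if s never shrank, and the
  correction for the first letter i is exactly what
  [borel_at1_mulX_deriv] takes away. *)
Lemma count_words c s N : (\sum_x c x = N)%N -> uniq s ->
  \sum_(w : N.-tuple T | has_content c w) (subseq s w)%:R =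
  N`!%:R / (\prod_x (c x)`!)%:R * borel_at1 (\prod_(y <- s) hit c y).
Proof.
elim: N c s => [|N IHN] c s cN us.
  have c0 x : c x = 0%N.
    by apply/eqP; move/eqP: cN; rewrite sum_nat_eq0 => /forallP /(_ x).
  rewrite (big_pred1 [tuple]) => [|w] /=; last first.
    by apply/forallP/eqP => _; [exact: tuple0|move=> x; rewrite c0 tuple0].
  rewrite big1 => [|x _]; last by rewrite c0.
  rewrite divr1 mul1r /=; case: s us => [|i s] _.
    by rewrite big_nil borel_at1_1.
  by rewrite big_cons /hit c0 misspoly0 subrr mul0r linear0.
rewrite (sum_tuple_cons _ (has_content c) (fun w => (subseq s w)%:R)).
set M := (\prod_x (c x)`!)%:R.
pose s_ x := if s is i :: s' then if i == x then s' else s else [::].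
have us_ x : uniq (s_ x).
  move: us; rewrite /s_; case: (s) => // i s' /= /andP[s'i us'];
  by case: ifP => //= _; rewrite s'i.
transitivity (N`!%:R / M * \sum_x (c x)%:R *
    borel_at1 (\prod_(y <- s_ x) hit (remove_letter c x) y)).
  rewrite mulr_sumr; apply: eq_bigr => x _.
  rewrite (eq_bigl _ _ (fun w : N.-tuple T => has_content_cons c x w)).
  have [->|cx_gt0] := posnP (c x); first by rewrite big_pred0_eq !(mul0r, mulr0).
  rewrite (eq_bigr (fun w : N.-tuple T => (subseq (s_ x) w)%:R)); last first.
    by move=> w _; rewrite /s_; case: (s) => [|i s'] //=; rewrite ?sub0seq.
  rewrite /= (IHN _ (s_ x)) ?(sum_remove_letter cN) // !mulrA; congr (_ * _).
  rewrite /M (prod_fact_remove_letter cx_gt0) natrM -mulrA; congr (_ * _).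
  by rewrite mulrC invfM mulVKf // pnatr_eq0 -lt0n.
rewrite factS natrM -[_ * N`!%:R]mulrC -!mulrA; congr (_ * _); rewrite mulrCA.
congr (_ * _).
case: s us @s_ us_ => [|i s'] us s_ us_.
  by rewrite /s_ -cN natr_sum mulr_suml; apply: eq_bigr => x _; rewrite !big_nil.
have borel_at1Z a (p : {poly K}) : borel_at1 (a *: p) = a * borel_at1 p.
  exact: linearZ.
have /andP[s'i us'] := us.
have prod_i : \prod_(y <- s') hit (remove_letter c i) y = \prod_(y <- s') hit c y.
  apply: eq_big_seq => y sy; rewrite /hit /remove_letter.
  by case: eqP sy s'i => [-> ->|_ _ _] //=; rewrite subn0.
(* The head factor is divisible by z, by [mulX_misspoly]; for c i = 0 it
   vanishes. *)
pose q := (c i)%:R *: (misspoly K (c i).-1 * \prod_(y <- s') hit c y).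
have prodE : \prod_(y <- i :: s') hit c y = 'X * q.
  rewrite big_cons /hit /q; case: (c i) => [|k].
    by rewrite misspoly0 subrr scale0r mul0r mulr0.
  by rewrite -mulX_misspoly !scalerAl -scalerAl mulrA -scalerAr.
have := congr1 (@borel_at1 K) (sum_remove_letter_prod c us).
rewrite linearB prodE /= borel_at1_mulX_deriv borel_at1Z cN => /(canLR (subrK _)) <-.
rewrite linear_sum (bigD1 i) //= [in RHS](bigD1 i) //= [RHS]addrAC borel_at1Z /s_ eqxx.
congr (_ + _).
  rewrite big_cons prod_i /hit /remove_letter eqxx subn1 mulrBl mul1r linearB.
  by rewrite mulrBr /q borel_at1Z subrK.
by apply: eq_bigr => x /negPf ne_xi; rewrite eq_sym ne_xi borel_at1Z.
Qed.

End Words.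

(** * The mean of L1 *)

Section MeanL1.

Lemma take_enum_ord n j : (j <= n)%N ->
  [seq (nat_of_ord i).+1 | i <- take j (enum 'I_n)] = iota 1 j.
Proof.
move=> le_jn.
have -> : [seq (nat_of_ord i).+1 | i <- take j (enum 'I_n)] =
    map S (take j (map val (enum 'I_n))) by rewrite -map_take -map_comp.
by rewrite val_enum_ord take_iota (minn_idPl le_jn) (iotaDl 1 0).
Qed.

Lemma subseq_map_inj (T1 T2 : eqType) (f : T1 -> T2) (s t : seq T1) :
  injective f -> subseq (map f s) (map f t) = subseq s t.
Proof.
move=> f_inj; elim: t s => [|y t IHt] [|x s] //=.
by rewrite (inj_eq f_inj) -IHt; case: (x == y); rewrite ?IHt.
Qed.

Lemma subseq_letters m n (w : (m * n).-tuple 'I_n) j : (j <= n)%N ->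
  subseq (iota 1 j) (letters w) = subseq (take j (enum 'I_n)) w.
Proof.
move=> /take_enum_ord <-; apply: (subseq_map_inj (f := fun i : 'I_n => i.+1)).
by move=> i k [] /val_inj.
Qed.

Lemma subseq_iotaS (s : seq nat) j k : (j <= k)%N ->
  subseq (iota 1 k) s -> subseq (iota 1 j) s.
Proof.
move=> le_jk; apply: subseq_trans.
by rewrite -(subnKC le_jk) iotaD prefix_subseq.
Qed.

(** A maximum becomes a sum of indicators, so that its mean is a sum of
  probabilities. *)
Lemma bigmax_downclosed n (P : pred nat) :
  P 0 -> (forall j k, (j <= k)%N -> P k -> P j) ->
  (\max_(j < n.+1 | P j) j = \sum_(1 <= j < n.+1) P j)%N.
Proof.
move=> P0 Pdown; elim: n => [|n IHn].
  by rewrite big_mkcond big_ord_recl big_ord0 big_geq //=; case: ifP.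
rewrite big_mkcond big_ord_recr /= -big_mkcond /= IHn [in RHS]big_nat_recr //=.
have [Pn1|_] := boolP (P n.+1); last by rewrite maxn0 addn0.
have -> : (\sum_(1 <= j < n.+1) P j = n)%N.
  rewrite (eq_big_nat _ _ (F2 := fun=> 1%N)).
    by rewrite sum_nat_const_nat muln1 subn1.
  by move=> j /andP[_ /ltnW /Pdown -> //].
by rewrite addn1 (maxn_idPr _).
Qed.

Lemma L1_sum m n (w : (m * n).-tuple 'I_n) :
  (L1 w = \sum_(1 <= j < n.+1) subseq (take j (enum 'I_n)) w)%N.
Proof.
rewrite /L1 (bigmax_downclosed n (P := fun j => subseq (iota 1 j) (letters w))).
- by apply: eq_big_nat => j /andP[_ lt_jn]; rewrite subseq_letters.
- exact: sub0seq.
- by move=> j k; apply: subseq_iotaS.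
Qed.

(** The pattern 1 2 .. j has j distinct letters of multiplicity m, so each
  probability is given by [count_words] and does not depend on n. *)
Lemma meanL1E (R : realType) m n : meanL1 R m n =
  \sum_(1 <= j < n.+1) borel_at1 ((1 - misspoly R m) ^+ j).
Proof.
pose c (x : 'I_n) := m.
have c_sum : (\sum_x c x = m * n)%N by rewrite sum_nat_const card_ord mulnC.
have multipermE (w : (m * n).-tuple 'I_n) : (w \in multiperm m n) = has_content c w.
  by rewrite inE.
set W : R := (m * n)`!%:R / (\prod_x (c x)`!)%:R.
have card_multiperm : #|multiperm m n|%:R = W.
  have := count_words R c_sum (isT : uniq [::]).
  rewrite big_nil borel_at1_1 mulr1 -/W => <-.
  rewrite -sum1_card natr_sum (eq_bigl _ _ multipermE).
  by apply: eq_bigr => w _; rewrite sub0seq.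
have W_neq0 : W != 0.
  rewrite mulf_neq0 ?invr_eq0 ?fact_natr_neq0 //.
  by rewrite pnatr_eq0 -lt0n prodn_gt0 // => x; rewrite fact_gt0.
rewrite /meanL1 card_multiperm; apply: (canLR (mulfK W_neq0)).
under eq_bigr => w _ do rewrite L1_sum natr_sum.
rewrite exchange_big mulr_suml; apply: eq_big_nat => j /andP[_ lt_jn].
rewrite (eq_bigl _ _ multipermE) mulrC (count_words R c_sum) ?take_uniq ?enum_uniq //.
congr (_ * borel_at1 _).
by rewrite /c big_const_seq count_predT iter_mulr_1 size_takel ?size_enum_ord.
Qed.
End MeanL1.

(** * Coefficientwise domination and convergence *)

Section Domination.
Variable K : numFieldType.
Implicit Types (p q P Q : {poly K}) (t : K).

(** Domination is stable under products, which gives bounds on the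
  coefficients of powers without computing them. *)
Definition dominated p P := forall k, `|p`_k| <= P`_k.

Definition abs_poly p := \poly_(k < size p) `|p`_k|.

Lemma dominated_abs p : dominated p (abs_poly p).
Proof.
by move=> k; rewrite coef_poly; case: ltnP => // ?; rewrite nth_default ?normr0.
Qed.

Lemma dominated_ge0 p P k : dominated p P -> 0 <= P`_k.
Proof. by move=> /(_ k); apply: le_trans. Qed.

Lemma dominatedM p P q Q : dominated p P -> dominated q Q -> dominated (p * q) (P * Q).
Proof.
move=> pP qQ k; rewrite !coefM (le_trans (ler_norm_sum _ _ _)) //.
by apply: ler_sum => i _; rewrite normrM ler_pM.
Qed.

Lemma dominatedX p P n : dominated p P -> dominated (p ^+ n) (P ^+ n).
Proof.
move=> pP; elim: n => [|n IHn]; last by rewrite !exprS; apply: dominatedM.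
by move=> k; rewrite !expr0 coef1 normr_nat.
Qed.

(** Divisibility by z^j makes every denominator k! at least j!. *)
Lemma dominated_borel_mulXn j q Q :
  dominated q Q -> dominated (borel ('X^j * q)) (j`!%:R^-1 *: ('X^j * Q)).
Proof.
move=> qQ k; rewrite coef_borel coefZ !coefXnM; case: ltnP => [_|le_jk].
  by rewrite mul0r mulr0 normr0.
rewrite normrM normfV normr_nat mulrC ler_pM ?invr_ge0 ?ler0n //.
by rewrite lef_pV2 ?posrE ?ltr0n ?fact_gt0 // ler_nat leq_fact.
Qed.

Lemma horner1_sum p n : (size p <= n)%N -> p.[1] = \sum_(k < n) p`_k.
Proof.
move=> le_pn; rewrite (horner_coef_wide _ le_pn).
by apply: eq_bigr => k _; rewrite expr1n mulr1.
Qed.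

Lemma dominated_horner p P t :
  dominated p P -> 0 <= t <= 1 -> `|p.[t]| <= P.[1].
Proof.
move=> pP /andP[t_ge0 t_le1]; set n := maxn (size p) (size P).
rewrite (horner1_sum (n := n)) ?leq_maxr // (horner_coef_wide (n := n)) ?leq_maxl //.
rewrite (le_trans (ler_norm_sum _ _ _)) //; apply: ler_sum => k _.
rewrite normrM normrX (ger0_norm t_ge0) -[leRHS]mulr1.
by rewrite ler_pM ?exprn_ge0 // exprn_ile1.
Qed.

Lemma horner1_tail p n N : (n <= N)%N -> (size p <= N)%N ->
  p.[1] - \sum_(k < n) p`_k = \sum_(n <= k < N) p`_k.
Proof.
move=> le_nN le_pN; rewrite (horner1_sum le_pN) -!(big_mkord xpredT (fun k => p`_k)).
by rewrite (big_cat_nat (leq0n n) le_nN) /= addrAC subrr add0r.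
Qed.

Lemma dominated_tail p P n : dominated p P ->
  `|p.[1] - \sum_(k < n) p`_k| <= P.[1] - \sum_(k < n) P`_k.
Proof.
move=> pP; set N := maxn n (maxn (size p) (size P)).
rewrite !(@horner1_tail _ n N) ?leq_maxl // ?leq_max ?leqnn ?orbT //.
by rewrite (le_trans (ler_norm_sum _ _ _)) // ler_sum.
Qed.

(** Markov's inequality with the weights 2^k. *)
Lemma tail_le_horner2 P n : (forall k, 0 <= P`_k) ->
  P.[1] - \sum_(k < n) P`_k <= P.[2] / 2 ^+ n.
Proof.
move=> P_ge0; set N := maxn n (size P).
rewrite (@horner1_tail _ n N) ?leq_maxl ?leq_maxr //.
rewrite ler_pdivlMr ?exprn_gt0 // (@horner_coef_wide _ N) ?leq_maxr //.
rewrite -(big_mkord xpredT (fun k => P`_k * 2 ^+ k)) (big_cat_nat (leq0n n)) ?leq_maxl //=.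
rewrite mulr_suml -[leLHS]add0r lerD //.
  by apply: sumr_ge0 => k _; rewrite mulr_ge0 ?exprn_ge0.
apply: ler_sum_nat => k /andP[le_nk _].
by rewrite ler_wpM2l // ler_eXn2l // ltr1n.
Qed.

Lemma hitE m : 1 - misspoly K m = 'X * (m%:R *: misspoly K m.-1).
Proof.
by case: m => [|m]; rewrite -?mulX_misspoly ?scalerAr // misspoly0 subrr scale0r mulr0.
Qed.

End Domination.

Section Convergence.
Variable R : realType.
Implicit Types (m n j : nat) (x : R).

Lemma sum_exp_le_expR x n : 0 <= x -> \sum_(j < n) x ^+ j / j`!%:R <= expR x.
Proof.
move=> x_ge0; rewrite -(big_mkord xpredT (fun j => x ^+ j / j`!%:R)).
apply: (nondecreasing_cvgn_le (u_ := series (exp_coeff x))).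
  by apply: nondecreasing_series => j _ _; rewrite exp_coeff_ge0.
exact: is_cvg_series_exp_coeff.
Qed.

(** The sum of the absolute values of the coefficients of
  (1 - misspoly m) / z. *)
Definition hit_bound m : R := (abs_poly (m%:R *: misspoly R m.-1)).[1].

Lemma hit_bound_ge0 m : 0 <= hit_bound m.
Proof.
rewrite /hit_bound (horner1_sum (leqnn _)) sumr_ge0 // => k _.
exact: dominated_ge0 (dominated_abs _).
Qed.

Lemma hitX m j :
  (1 - misspoly R m) ^+ j = 'X^j * (m%:R *: misspoly R m.-1) ^+ j.
Proof. by rewrite hitE exprMn_comm //; apply: mulrC. Qed.

Lemma dominated_borel_hitX m j :
  dominated (borel ((1 - misspoly R m) ^+ j))
    (j`!%:R^-1 *: ('X^j * abs_poly (m%:R *: misspoly R m.-1) ^+ j)).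
Proof.
by rewrite hitX; apply/dominated_borel_mulXn/dominatedX/dominated_abs.
Qed.

Lemma borel_hitX_le m j x : 0 <= x <= 1 ->
  `|(borel ((1 - misspoly R m) ^+ j)).[x]| <= hit_bound m ^+ j / j`!%:R.
Proof.
move=> x01; rewrite (le_trans (dominated_horner (@dominated_borel_hitX m j) x01)) //.
by rewrite hornerZ hornerM hornerXn horner_exp expr1n mul1r mulrC.
Qed.

Lemma borel_mulX_hitX_le m j x : 0 <= x <= 1 ->
  `|(borel ('X * (1 - misspoly R m) ^+ j)).[x]| <= hit_bound m ^+ j / j.+1`!%:R.
Proof.
move=> x01; rewrite hitX mulrA -exprS.
have dom := dominated_borel_mulXn j.+1
    (dominatedX j (dominated_abs (m%:R *: misspoly R m.-1))).
rewrite (le_trans (dominated_horner dom x01)) //.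
by rewrite hornerZ hornerM hornerXn horner_exp expr1n mul1r mulrC.
Qed.

(** Comparison with the exponential series of [hit_bound m]. *)
Lemma is_cvg_meanL1 m : cvgn (meanL1 R m).
Proof.
have -> : meanL1 R m =
    (fun n => series (fun j => borel_at1 ((1 - misspoly R m) ^+ j)) n.+1 - 1).
  apply/funext => n; rewrite meanL1E /series /= [in RHS]big_ltn // expr0 borel_at1_1.
  by rewrite [RHS]addrC addKr.
apply: is_cvgB; last exact: is_cvg_cst.
pose s := series (fun j => borel_at1 ((1 - misspoly R m) ^+ j)).
suff cvg_s : cvgn s by apply/cvg_ex; exists (limn s); rewrite (cvg_shiftS s).
apply: normed_cvg.
apply: (series_le_cvg _ _ _ (is_cvg_series_exp_coeff (hit_bound m))) => j /=.
- exact: normr_ge0.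
- by rewrite exp_coeff_ge0 // hit_bound_ge0.
- by rewrite borel_hitX_le // ler01 lexx.
Qed.

End Convergence.

(** * The zeroes of the truncated exponential *)

Section Zeroes.
Variable K : numFieldType.
Implicit Types (s : seq K) (m N : nat).

(** The sum over a of the series 1 / (1 + a z), truncated at order N. *)
Definition geom_poly s N : {poly K} :=
  \sum_(a <- s) \sum_(k < N) (- a) ^+ k *: 'X^k.

Lemma coef_geom_poly s N k :
  (geom_poly s N)`_k = if (k < N)%N then \sum_(a <- s) (- a) ^+ k else 0.
Proof.
rewrite /geom_poly coef_sum; have [lt_kN|le_Nk] := ltnP k N.
  apply: eq_bigr => a _; rewrite coef_sum (bigD1 (Ordinal lt_kN)) //= big1 => [|i ne_ik].
    by rewrite coefZ coefXn eqxx mulr1 addr0.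
  have /negPf ne : k != i by apply: contraNneq ne_ik => ki; apply/eqP/val_inj.
  by rewrite coefZ coefXn ne mulr0.
rewrite big1 // => a _; rewrite coef_sum big1 // => i _.
by rewrite coefZ coefXn gtn_eqF ?mulr0 // (leq_trans _ le_Nk).
Qed.

(** The logarithmic derivative of the product, modulo z^N.  Working modulo
  z^N allows repeated entries in s and needs no partial fractions. *)
Lemma prod_mul_geom_poly s N : exists r,
  \prod_(a <- s) (1 + a *: 'X) * geom_poly s N =
  (size s)%:R *: \prod_(a <- s) (1 + a *: 'X)
    - 'X * deriv (\prod_(a <- s) (1 + a *: 'X)) + 'X^N * r.
Proof.
elim: s => [|a s [r IHs]].
  by exists 0; rewrite /geom_poly !big_nil derivC !(mulr0, scale0r) subr0 addr0.
rewrite /geom_poly !big_cons -/(geom_poly s N); set P := \prod_(_ <- s) _ in IHs *.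
(* The truncation error of the geometric series goes into r. *)
have geom : (1 + a *: 'X) * \sum_(k < N) (- a) ^+ k *: 'X^k = 1 - (- a) ^+ N *: 'X^N.
  under eq_bigr => k _ do rewrite -exprZn.
  by rewrite -exprZn -[RHS]opprB subrX1 -mulNr opprB scaleNr opprK.
exists ((1 + a *: 'X) * r - (- a) ^+ N *: P).
transitivity (P * ((1 + a *: 'X) * \sum_(k < N) (- a) ^+ k *: 'X^k)
    + (1 + a *: 'X) * (P * geom_poly s N)); first by ring.
have deriv_aX : deriv (1 + a *: 'X) = a%:P.
  by rewrite derivD derivC add0r derivZ derivX -mul_polyC mulr1.
rewrite geom IHs derivM deriv_aX -!mul_polyC.
have -> : (size (a :: s))%:R%:P = (size s)%:R%:P + 1 :> {poly K}.
  by rewrite /= -natr1 polyCD.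
ring.
Qed.

Lemma prodXsubC_rev s (x : K) : x != 0 ->
  (\prod_(a <- s) (1 + a *: 'X)).[x] =
  (- x) ^+ size s * (\prod_(a <- s) ('X - a%:P)).[- x^-1].
Proof.
move=> x_neq0; rewrite !horner_prod; elim: s => [|a s IHs] /=.
  by rewrite !big_nil mulr1.
rewrite !big_cons IHs.
have -> : (1 + a *: 'X).[x] = - x * ('X - a%:P).[- x^-1].
  rewrite hornerXsubC hornerD hornerC hornerZ hornerX.
  by rewrite mulrBr mulrNN divff // mulNr opprK mulrC.
by rewrite exprS mulrACA.
Qed.

Lemma poly_eq_nonzero (p q : {poly K}) : (forall x, x != 0 -> p.[x] = q.[x]) -> p = q.
Proof.
move=> eq_pq; apply/eqP; rewrite -subr_eq0; apply/eqP.
pose rs : seq K := [seq k.+1%:R | k <- iota 0 (size (p - q))].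
apply: (@roots_geq_poly_eq0 _ _ rs); last by rewrite size_map size_iota.
  apply/allP => _ /mapP[k _ ->]; by rewrite rootE hornerD hornerN eq_pq ?subrr ?pnatr_eq0.
by rewrite map_inj_uniq ?iota_uniq // => i j /eqP; rewrite eqr_nat => /eqP[].
Qed.

End Zeroes.

Section TruncatedExponential.
Variable R : realType.
Implicit Types (m : nat) (s : seq R[i]).

(** [misspoly m] is m! E_m with its coefficients in reverse order, and with
  -z for z; so it vanishes at the points -1 / alpha_i. *)
Lemma misspoly_prod m s :
  size s = m -> truncexp R m = lead_coef (truncexp R m) *: \prod_(a <- s) ('X - a%:P) ->
  misspoly R[i] m = \prod_(a <- s) (1 + a *: 'X).
Proof.
move=> sz_s; have -> : lead_coef (truncexp R m) = m`!%:R^-1.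
  by rewrite lead_coef_poly // invr_eq0 fact_natr_neq0.
move=> Es; apply: poly_eq_nonzero => x x_neq0.
rewrite prodXsubC_rev // sz_s.
have -> : \prod_(a <- s) ('X - a%:P) = m`!%:R *: truncexp R m.
  by rewrite Es scalerA divff ?scale1r // fact_natr_neq0.
rewrite hornerZ !horner_poly mulr_sumr mulr_sumr (reindex_inj rev_ord_inj) /=.
apply: eq_bigr => k _; rewrite subSS.
have le_km : (k <= m)%N by rewrite -ltnS.
have -> : m`!%:R = (m ^_ (m - k))%:R * k`!%:R :> R[i].
  by have := ffact_fact (leq_subr k m); rewrite subKn // -natrM => ->.
have -> : (- x) ^+ m = (- x) ^+ (m - k) * (- x) ^+ k by rewrite -exprD subnK.
have xk : (- x) ^+ k * (- x^-1) ^+ k = 1 by rewrite -exprMn mulrNN divff ?expr1n.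
transitivity ((- x) ^+ (m - k) * (m ^_ (m - k))%:R * (k`!%:R / k`!%:R)
  * ((- x) ^+ k * (- x^-1) ^+ k)); last by ring.
rewrite xk divff ?fact_natr_neq0 // !mulr1 [(- x) ^+ (m - k)]exprNn; ring.
Qed.

(** E_m and its derivative both take the value 1 at 0, and the logarithmic
  derivative of E_m at 0 is minus the sum of the inverses of the zeroes. *)
Lemma sum_inv_zeroes m s : (0 < m)%N ->
  truncexp R m = lead_coef (truncexp R m) *: \prod_(a <- s) ('X - a%:P) ->
  all (fun a => a != 0) s /\ \sum_(a <- s) a^-1 = -1.
Proof.
set c := lead_coef _ => m_gt0 Es.
have E0 : (truncexp R m).[0] = 1.
  by rewrite horner_coef0 coef_poly invr1.
have E1 : (deriv (truncexp R m)).[0] = 1.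
  by rewrite horner_coef0 coef_deriv coef_poly ltnS m_gt0 invr1.
have s_neq0 : all (fun a => a != 0) s.
  apply/allP => a sa; apply: contra_eq_neq E0 => a0.
  rewrite Es hornerZ horner_prod (big_rem a sa) /= hornerXsubC a0 subrr mul0r mulr0.
  by rewrite eq_sym oner_eq0.
split => //; move: E0 E1; rewrite Es derivZ !hornerZ.
have -> : (deriv (\prod_(a <- s) ('X - a%:P))).[0] =
    - (\prod_(a <- s) ('X - a%:P)).[0] * \sum_(a <- s) a^-1.
  elim: s s_neq0 {Es} => [|a s IHs] /=; first by rewrite !big_nil derivC hornerC mulr0.
  move=> /andP[a_neq0 s_neq0]; rewrite !big_cons derivM derivXsubC mul1r.
  rewrite hornerD !hornerM hornerXsubC IHs // sub0r.
  by set P0 := _.[0]; field.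
move=> E0; rewrite mulrA mulrN E0 mulN1r => /eqP.
by rewrite eqr_oppLR => /eqP.
Qed.

End TruncatedExponential.

(** * The renewal series as a sum over the zeroes *)

Section Renewal.
Variable K : numFieldType.

(** Partial sums of the Neumann series for the inverse of [misspoly m]. *)
Definition renewal_poly m N : {poly K} := \sum_(j < N.+1) (1 - misspoly K m) ^+ j.

Lemma misspoly_mul_renewal m N :
  misspoly K m * renewal_poly m N = 1 - (1 - misspoly K m) ^+ N.+1.
Proof.
by rewrite -[RHS]opprB subrX1 -mulNr opprB opprB addrCA subrr addr0.
Qed.

(** Both sides invert [misspoly m] modulo z^(N+1). *)
Lemma coef_renewal_poly m s N k : size s = m ->
    misspoly K m = \prod_(a <- s) (1 + a *: 'X) -> (k <= N)%N ->
  (renewal_poly m N)`_k = if k is k'.+1 then \sum_(a <- s) (- a) ^+ k' else 1.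
Proof.
move=> sz_s misspolyE le_kN; set B := misspoly K m in misspolyE.
have [r] := prod_mul_geom_poly s N; rewrite -misspolyE sz_s mulX_deriv_misspoly.
rewrite -/B -scalerBr subKr => geomE.
have inv_B : B * (1 + 'X * geom_poly s N) = 1 + 'X^(N.+1) * r.
  rewrite mulrDr mulr1 mulrCA geomE mulrDr mulrA -exprS.
  case: (m) @B misspolyE geomE => [|n] B _ _.
    by rewrite scale0r mulr0 add0r /B misspoly0.
  by rewrite -scalerAr mulX_misspoly addrA [B + _]addrC subrK.
have renE : B * renewal_poly m N = 1 - 'X^(N.+1) * (m%:R *: misspoly K m.-1) ^+ N.+1.
  by rewrite misspoly_mul_renewal hitE exprMn.
set V := renewal_poly m N in renE *; set C := 1 + _ in inv_B.
set u := (_ *: _) ^+ N.+1 in renE.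
(* V and C agree up to order N, since V * (B * C) = C * (B * V). *)
have -> : V = C - 'X^(N.+1) * (u * C + r * V).
  apply: (addIr ('X^(N.+1) * (u * C + r * V))); rewrite subrK.
  have : V * (B * C) = C * (B * V) by ring.
  rewrite inv_B renE => /(congr1 (fun p => p + 'X^(N.+1) * u * C)) E.
  transitivity (V * (1 + 'X^(N.+1) * r) + 'X^(N.+1) * u * C).
    ring.
  by rewrite E; ring.
rewrite coefB coefXnM ltnS le_kN subr0 /C coefD coef1 coefXM coef_geom_poly.
by case: k le_kN => [|k] /= lt_kN; rewrite ?lt_kN ?addr0 ?add0r.
Qed.

End Renewal.

Section RealToComplex.
Variable R : realType.

Lemma map_misspoly m : map_poly (real_complex R) (misspoly R m) = misspoly R[i] m.
Proof.
apply/polyP => k.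
by rewrite coef_map /= !coef_misspoly rmorphM rmorphXn rmorphN rmorph1 rmorph_nat.
Qed.

Lemma map_renewal_poly m N :
  map_poly (real_complex R) (renewal_poly R m N) = renewal_poly R[i] m N.
Proof.
rewrite /renewal_poly rmorph_sum; apply: eq_bigr => j _.
by rewrite rmorphXn rmorphB rmorph1 /= map_misspoly.
Qed.

Definition exp_sum (K : numFieldType) (z : K) n := \sum_(k < n) z ^+ k / k`!%:R.

(** Term by term, z^(k+1) / (k+1)! at 1 turns the geometric series of ratio
  - a into (1 - e^(-a)) / a. *)
Lemma truncated_renewal m (s : seq R[i]) N :
    (0 < m)%N -> size s = m ->
    truncexp R m = lead_coef (truncexp R m) *: \prod_(a <- s) ('X - a%:P) ->
  (\sum_(k < N.+1) (borel (renewal_poly R m N))`_k)%:C =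
  - \sum_(a <- s) a^-1 * exp_sum (- a) N.+1.
Proof.
move=> m_gt0 sz_s Es; have [s_neq0 sum_inv] := sum_inv_zeroes m_gt0 Es.
have misspolyE := misspoly_prod sz_s Es.
transitivity (1 + \sum_(a <- s) \sum_(k < N) (- a) ^+ k / k.+1`!%:R).
  rewrite rmorph_sum big_ord_recl exchange_big /=; congr (_ + _).
    rewrite coef_borel divr1 -coef_map map_renewal_poly.
    by rewrite (coef_renewal_poly sz_s misspolyE).
  apply: eq_bigr => k _; rewrite coef_borel rmorphM fmorphV rmorph_nat /=.
  rewrite -coef_map map_renewal_poly (coef_renewal_poly sz_s misspolyE) //=.
  by rewrite mulr_suml.
transitivity (- (\sum_(a <- s) a^-1) + \sum_(a <- s) \sum_(k < N) (- a) ^+ k / k.+1`!%:R).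
  by rewrite sum_inv opprK.
rewrite -!sumrN -big_split /=; apply: eq_big_seq => a sa.
have a_neq0 : a != 0 by apply: (allP s_neq0).
rewrite /exp_sum big_ord_recl expr0 divr1 mulrDr mulr1 opprD; congr (_ + _).
rewrite -mulrN -sumrN mulr_sumr; apply: eq_bigr => k _.
by rewrite lift0 exprS; field; rewrite a_neq0 fact_natr_neq0.
Qed.

End RealToComplex.

(** * The complex exponential series *)

Section ExpSum.
Variable K : numFieldType.
Implicit Types (x y z : K).

(** The left-hand side collects the terms x^i y^j / (i! j!) with i, j < n and
  n <= i + j; taking absolute values term by term gives the right-hand side.
  That is a real quantity, so the functional equation of the real exponential
  makes it tend to 0 for complex x and y. *)
Lemma exp_sum_product_error x y n :
  `|exp_sum x n * exp_sum y n - exp_sum (x + y) n| <=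
  exp_sum `|x| n * exp_sum `|y| n - exp_sum (`|x| + `|y|) n.
Proof.
pose e z : {poly K} := \poly_(k < n) (z ^+ k / k`!%:R).
have e1 z : (e z).[1] = exp_sum z n.
  by rewrite (horner1_sum (size_poly _ _)); apply: eq_bigr => k _; rewrite coef_poly ltn_ord.
have coef_ee z t : \sum_(k < n) (e z * e t)`_k = exp_sum (z + t) n.
  apply: eq_bigr => k _; rewrite exprDn mulr_suml coefM.
  rewrite (reindex_inj rev_ord_inj) /=; apply: eq_bigr => i _.
  have le_ik : (i <= k)%N by rewrite -ltnS.
  rewrite subSS subKn // !coef_poly (leq_ltn_trans (leq_subr _ _)) ?ltn_ord //.
  rewrite (leq_ltn_trans le_ik) ?ltn_ord //.
  rewrite -(bin_fact le_ik) -mulr_natr !natrM.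
  have bin_neq0 : 'C(k, i)%:R != 0 :> K by rewrite pnatr_eq0 -lt0n bin_gt0.
  by field; rewrite bin_neq0 !fact_natr_neq0.
have dom z : dominated (e z) (e `|z|).
  move=> k; rewrite !coef_poly; case: ifP; rewrite ?normr0 // => _.
  by rewrite normrM normrX normfV normr_nat.
by have := dominated_tail n (dominatedM (dom x) (dom y)); rewrite !hornerM !e1 !coef_ee.
Qed.

End ExpSum.

Section ComplexLimits.
Variable R : realType.
Implicit Types (u v : nat -> R[i]) (z l : R[i]).

Let ReD z l : complex.Re (z + l) = complex.Re z + complex.Re l.
Proof. by case: z l => [a b] [c d]. Qed.

Let ImD z l : complex.Im (z + l) = complex.Im z + complex.Im l.
Proof. by case: z l => [a b] [c d]. Qed.

Let ReM z l : complex.Re (z * l) =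
  complex.Re z * complex.Re l - complex.Im z * complex.Im l.
Proof. by case: z l => [a b] [c d]. Qed.

Let ImM z l : complex.Im (z * l) =
  complex.Re z * complex.Im l + complex.Im z * complex.Re l.
Proof. by case: z l => [a b] [c d]. Qed.

(** Convergence of complex sequences through real and imaginary parts, which
  avoids putting a topology on R[i]. *)
Definition cvg_complex u l :=
  complex.Re (u n) @[n --> \oo] --> complex.Re l /\
  complex.Im (u n) @[n --> \oo] --> complex.Im l.

Lemma cvg_complex_real (w : nat -> R) (x : R) :
  w n @[n --> \oo] --> x -> cvg_complex (fun n => (w n)%:C) x%:C.
Proof. by move=> wx; split => //=; apply: cvg_cst. Qed.

Lemma cvg_complex_cst z : cvg_complex (fun=> z) z.
Proof. by split; apply: cvg_cst. Qed.

Lemma cvg_complexD u v z l :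
  cvg_complex u z -> cvg_complex v l -> cvg_complex (fun n => u n + v n) (z + l).
Proof.
case: z l => [a b] [c d] [/= ua ub] [/= vc vd]; split => /=.
  have -> : (fun n => complex.Re (u n + v n)) =
      (fun n => complex.Re (u n)) + (fun n => complex.Re (v n)).
    by apply/funext => n; rewrite ReD.
  exact: cvgD.
have -> : (fun n => complex.Im (u n + v n)) =
    (fun n => complex.Im (u n)) + (fun n => complex.Im (v n)).
  by apply/funext => n; rewrite ImD.
exact: cvgD.
Qed.

Lemma cvg_complexM u v z l :
  cvg_complex u z -> cvg_complex v l -> cvg_complex (fun n => u n * v n) (z * l).
Proof.
case: z l => [a b] [c d] [/= ua ub] [/= vc vd]; split => /=.
  have -> : (fun n => complex.Re (u n * v n)) =
      (fun n => complex.Re (u n)) \* (fun n => complex.Re (v n)) -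
      (fun n => complex.Im (u n)) \* (fun n => complex.Im (v n)).
    by apply/funext => n; rewrite ReM.
  by apply: cvgB; apply: cvgM.
have -> : (fun n => complex.Im (u n * v n)) =
    (fun n => complex.Re (u n)) \* (fun n => complex.Im (v n)) +
    (fun n => complex.Im (u n)) \* (fun n => complex.Re (v n)).
  by apply/funext => n; rewrite ImM.
by apply: cvgD; apply: cvgM.
Qed.

Lemma cvg_complexN u z : cvg_complex u z -> cvg_complex (fun n => - u n) (- z).
Proof.
move=> uz; have -> : (fun n => - u n) = (fun n => -1 * u n).
  by apply/funext => n; rewrite mulN1r.
by rewrite -(mulN1r z); exact: (cvg_complexM (cvg_complex_cst (-1)) uz).
Qed.

Lemma cvg_complex_sum (I : Type) (s : seq I) (u : I -> nat -> R[i]) (l : I -> R[i]) :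
  (forall i, cvg_complex (u i) (l i)) ->
  cvg_complex (fun n => \sum_(i <- s) u i n) (\sum_(i <- s) l i).
Proof.
move=> ul; elim: s => [|i s IHs].
  have -> : (fun n => \sum_(i <- [::]) u i n) = fun=> 0.
    by apply/funext => n; rewrite big_nil.
  by rewrite big_nil; apply: cvg_complex_cst.
have -> : (fun n => \sum_(j <- i :: s) u j n) = fun n => u i n + \sum_(j <- s) u j n.
  by apply/funext => n; rewrite big_cons.
by rewrite big_cons; apply: cvg_complexD.
Qed.

Lemma cvg_complex_unique u z l : cvg_complex u z -> cvg_complex u l -> z = l.
Proof.
case: z l => [a b] [c d] [/= ua ub] [/= vc vd].
by congr Complex; [apply: (cvg_unique _ ua vc)|apply: (cvg_unique _ ub vd)].
Qed.

Lemma Re_Im_norm_le z (e : R) : `|z| <= e%:C -> `|complex.Re z| <= e /\ `|complex.Im z| <= e.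
Proof.
move=> ze; rewrite -!lecR; split; first exact: le_trans (normc_ge_Re z) ze.
rewrite (le_trans _ ze) // -[`|z|]mulr1 -(normr1 R[i]).
have <- : `|'i%C : R[i]| = `|1|.
  by rewrite normr1 normc_def /= expr0n add0r expr1n sqrtr1.
rewrite -normrM; have := normc_ge_Re (z * 'i%C).
by rewrite ReiNIm normrN.
Qed.

Lemma cvg_complex_squeeze u (e : nat -> R) :
  (forall n, `|u n| <= (e n)%:C) -> e n @[n --> \oo] --> 0 -> cvg_complex u 0.
Proof.
move=> ue e0.
have squeeze (w : nat -> R) : (forall n, `|w n| <= e n) -> w n @[n --> \oo] --> 0.
  move=> we; apply/norm_cvg0P; apply: (squeeze_cvgr _ (cvg_cst 0) e0).
  by apply: nearW => n; rewrite normr_ge0 we.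
by split; apply: squeeze => n; have [] := Re_Im_norm_le (ue n).
Qed.

Lemma cvg_exp_sum (x : R) : exp_sum x n @[n --> \oo] --> expR x.
Proof.
have -> : (fun n => exp_sum x n) = series (exp_coeff x).
  by apply/funext => n; rewrite /series /= big_mkord.
exact: is_cvg_series_exp_coeff.
Qed.

Lemma exp_sum_real (x : R) n : exp_sum x%:C n = (exp_sum x n)%:C.
Proof.
rewrite /exp_sum rmorph_sum; apply: eq_bigr => k _.
by rewrite rmorphM rmorphXn fmorphV rmorph_nat.
Qed.

Lemma exp_sum_imag (y : R) n :
  exp_sum (y *i) n = series (cos_coeff y) n +i* series (sin_coeff y) n.
Proof.
rewrite /exp_sum /series /= !big_mkord; elim: n => [|n IHn].
  by rewrite !big_ord0.
rewrite !big_ord_recr /= IHn.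
suff -> : (y *i) ^+ n / n`!%:R = cos_coeff y n +i* sin_coeff y n by [].
have -> : (y *i : R[i]) = y%:C * 'i%C by simpc.
rewrite exprMn -(rmorph_nat (real_complex R)) -fmorphV -rmorphXn /=.
have -> : 'i%C ^+ n =
    ((~~ odd n)%:R * (-1) ^+ n./2) +i* ((odd n)%:R * (-1) ^+ n.-1./2) :> R[i].
  rewrite -{1}(odd_double_half n) exprD -mul2n exprM sqr_i.
  rewrite -(rmorphN1 (real_complex R)) -rmorphXn.
  case: (boolP (odd n)) => [odd_n|_] /=; simpc.
    by rewrite -[in n.-1](odd_double_half n) odd_n add1n /= doubleK.
  by [].
rewrite /cos_coeff /sin_coeff /= -?exprnP; simpc.
by congr (_ +i* _); ring.
Qed.

(** For z = x + i y, the product of the series at x and at i y converges to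
  [expC z] by the definitions of the real functions exp, cos and sin; its
  distance to the series at z is controlled by
  [exp_sum_product_error]. *)
Lemma cvg_exp_sum_complex z : cvg_complex (exp_sum z) (expC z).
Proof.
case: z => x y; set z := x +i* y.
have zE : z = x%:C + y *i by rewrite /z; simpc.
have cvg_prod : cvg_complex (fun n => exp_sum x%:C n * exp_sum (y *i) n) (expC z).
  have -> : expC z = (expR x)%:C * (cos y +i* sin y) by rewrite /=; simpc.
  apply: cvg_complexM.
    by rewrite (funext (exp_sum_real x)); exact/cvg_complex_real/cvg_exp_sum.
  rewrite (funext (exp_sum_imag y)).
  split => /=; rewrite unlock.
    exact: is_cvg_series_cos_coeff.
  exact: is_cvg_series_sin_coeff.
have cvg_err : cvg_complex (fun n => exp_sum x%:C n * exp_sum (y *i) n - exp_sum z n) 0.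
  apply: (@cvg_complex_squeeze _ (fun n =>
      exp_sum `|x| n * exp_sum `|y| n - exp_sum (`|x| + `|y|) n)) => [n|].
    rewrite zE; apply: le_trans (exp_sum_product_error _ _ _) _.
    have -> : `|x%:C| = `|x|%:C by rewrite normc_def /= expr0n addr0 sqrtr_sqr.
    have -> : `|y *i| = `|y|%:C :> R[i] by rewrite normc_def /= expr0n add0r sqrtr_sqr.
    by rewrite -rmorphD !exp_sum_real -rmorphM -rmorphB.
  rewrite -(subrr (expR (`|x| + `|y|))) {1}expRD.
  by apply: cvgB; [apply: cvgM|]; apply: cvg_exp_sum.
have := cvg_complexD cvg_prod (cvg_complexN cvg_err).
rewrite oppr0 addr0; congr cvg_complex; apply/funext => n.
by rewrite opprB addrCA subrr addr0.
Qed.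

End ComplexLimits.

(** * The limit as a sum over the zeroes *)

Section PartA.
Variable R : realType.

Lemma meanL1_renewal m N : meanL1 R m N = borel_at1 (renewal_poly R m N) - 1.
Proof.
rewrite meanL1E /renewal_poly linear_sum.
rewrite -(big_mkord xpredT (fun j => borel_at1 ((1 - misspoly R m) ^+ j))).
by rewrite [in RHS]big_ltn // expr0 borel_at1_1 [RHS]addrC addKr.
Qed.

(** The coefficients of order at most N of [renewal_poly m N] are those of the
  full renewal series; the others are small, by the bound C^j / j! on the
  weighted size of the image of the j-th power. *)
Lemma renewal_tail m N :
  `|borel_at1 (renewal_poly R m N) - \sum_(k < N.+1) (borel (renewal_poly R m N))`_k|
  <= expR (2 * (abs_poly (m%:R *: misspoly R m.-1)).[2]) / 2 ^+ N.+1.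
Proof.
set Psi := abs_poly _.
pose P := \sum_(j < N.+1) j`!%:R^-1 *: ('X^j * Psi ^+ j).
have dom : dominated (borel (renewal_poly R m N)) P.
  move=> k; rewrite /renewal_poly linear_sum !coef_sum.
  rewrite (le_trans (ler_norm_sum _ _ _)) //; apply: ler_sum => j _.
  exact: dominated_borel_hitX.
have P2 : P.[2] <= expR (2 * Psi.[2]).
  have -> : P.[2] = \sum_(j < N.+1) (2 * Psi.[2]) ^+ j / j`!%:R.
    rewrite horner_sum; apply: eq_bigr => j _.
    by rewrite hornerZ hornerM hornerXn horner_exp -exprMn mulrC.
  apply: sum_exp_le_expR; rewrite mulr_ge0 // horner_coef sumr_ge0 // => k _.
  by rewrite mulr_ge0 ?exprn_ge0 // (dominated_ge0 _ (dominated_abs _)).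
apply: le_trans (dominated_tail N.+1 dom) _.
apply: le_trans (tail_le_horner2 _ _) _ => [k|]; first exact: dominated_ge0 dom.
by rewrite ler_wpM2r // invr_ge0 exprn_ge0.
Qed.

Theorem limL1_zeroes m (alpha : m.-tuple R[i]) :
  (0 < m)%N -> zeroes_of (truncexp R m) alpha ->
  (limL1 R m)%:C = - 1 - \sum_(i < m) (tnth alpha i)^-1 * expC (- tnth alpha i).
Proof.
move=> m_gt0 alphaE; rewrite -(big_tuple _ _ alpha xpredT (fun a => a^-1 * expC (- a))).
have {}alphaE : truncexp R m = lead_coef (truncexp R m) *: \prod_(a <- alpha) ('X - a%:P).
  by rewrite big_tuple.
apply: (@cvg_complex_unique _ (fun n => (meanL1 R m n)%:C)).
  exact/cvg_complex_real/is_cvg_meanL1.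
pose tail n := borel_at1 (renewal_poly R m n)
    - \sum_(k < n.+1) (borel (renewal_poly R m n))`_k.
have tail0 : tail n @[n --> \oo] --> 0.
  apply/norm_cvg0P; pose C := expR (2 * (abs_poly (m%:R *: misspoly R m.-1)).[2]).
  apply: (squeeze_cvgr (f := fun=> 0) (h := fun n => C / 2 ^+ n.+1)).
  - by apply: nearW => n; rewrite normr_ge0 renewal_tail.
  - exact: cvg_cst.
  - have -> : (fun n => C / 2 ^+ n.+1) = geometric (C / 2) (1 / 2).
      by apply/funext => n; rewrite /= expr_div_n expr1n exprS invfM mul1r mulrA.
    by apply: cvg_geometric; rewrite ger0_norm ?ltr_pdivrMr ?mul1r ?ltr1n // divr_ge0.
have -> : (fun n => (meanL1 R m n)%:C) = fun n => (-1) + ((tail n)%:C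
    - \sum_(a <- alpha) a^-1 * exp_sum (- a) n.+1).
  apply/funext => n; rewrite -(truncated_renewal n m_gt0 (size_tuple alpha) alphaE).
  by rewrite meanL1_renewal -rmorphD /tail subrK rmorphB rmorph1 addrC.
rewrite -[X in _ + X]add0r.
apply: cvg_complexD (cvg_complex_cst _) _; apply: cvg_complexD.
  exact: (cvg_complex_real tail0).
apply: cvg_complexN.
apply: (@cvg_complex_sum _ _ _ (fun a n => a^-1 * exp_sum (- a) n.+1)) => a.
apply: cvg_complexM (cvg_complex_cst _) _.
have [Re_exp Im_exp] := cvg_exp_sum_complex (- a).
by split; rewrite (cvg_shiftS (fun n => _ (exp_sum (- a) n))).
Qed.

End PartA.

(** * Convolution of polynomials *)

Section Convolution.
Variable R : rcfType.
Implicit Types (p q A B : {poly R}) (t : R).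

Definition antideriv p : {poly R} := \poly_(k < (size p).+1) (p`_k.-1 / k%:R).

Lemma coef_antideriv p k : (antideriv p)`_k = p`_k.-1 / k%:R.
Proof.
rewrite coef_poly; case: k => [|k] /=; first by rewrite invr0 mulr0.
by rewrite ltnS; case: ltnP => // le_pk; rewrite nth_default ?mul0r.
Qed.

Fact antideriv_is_linear : linear antideriv.
Proof.
by move=> a p q; apply/polyP => k; rewrite !(coef_antideriv, coefD, coefZ) mulrDl mulrA.
Qed.
HB.instance Definition _ :=
  GRing.isLinear.Build R {poly R} {poly R} _ antideriv antideriv_is_linear.

Lemma antideriv0 p : (antideriv p).[0] = 0.
Proof. by rewrite horner_coef0 coef_antideriv invr0 mulr0. Qed.

Lemma deriv_antideriv p : deriv (antideriv p) = p.
Proof.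
apply/polyP => k; rewrite coef_deriv coef_antideriv -[LHS]mulr_natr.
by rewrite divfK // pnatr_eq0.
Qed.

Lemma antideriv_deriv p t : (antideriv (deriv p)).[t] = p.[t] - p.[0].
Proof.
have -> : antideriv (deriv p) = p - (p.[0])%:P.
  apply/polyP => -[|k]; rewrite coef_antideriv coefB coefC /=.
    by rewrite horner_coef0 subrr invr0 mulr0.
  by rewrite coef_deriv subr0 -[_ *+ _]mulr_natr mulfK // pnatr_eq0.
by rewrite hornerD hornerN hornerC.
Qed.

Lemma antideriv_borel p : antideriv (borel p) = borel ('X * p).
Proof.
apply/polyP => -[|k]; rewrite coef_antideriv !coef_borel coefXM /=.
  by rewrite invr0 mulr0 mul0r.
by rewrite factS natrM invfM mulrA mulrAC.
Qed.

(** The mean value theorem, applied to the antiderivative of the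
  difference. *)
Lemma le_antideriv A B t : 0 <= t -> (forall u, 0 <= u <= t -> A.[u] <= B.[u]) ->
  (antideriv A).[t] <= (antideriv B).[t].
Proof.
rewrite le_eqVlt => /predU1P[<- _|t_gt0 le_AB]; first by rewrite !antideriv0.
rewrite -subr_ge0 -hornerN -hornerD -linearB /=.
have [u u0t] := poly_mvt (antideriv (B - A)) t_gt0.
rewrite antideriv0 !subr0 deriv_antideriv => ->.
rewrite mulr_ge0 ?(ltW t_gt0) // hornerD hornerN subr_ge0 le_AB //.
by move: u0t; rewrite in_itv /= => /andP[/ltW -> /ltW ->].
Qed.

(** The right-hand side is the integral over [0, t] of the image of p at u
  times the image of q at t - u.  Integration by parts moves a factor z from
  q to p, with vanishing boundary terms, until q is constant. *)
Lemma borel_convolution p q t :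
  (borel ('X * (p * q))).[t] = (antideriv (borel p * (borel q \Po (t%:P - 'X)))).[t].
Proof.
elim/poly_ind: q p => [|q c IHq] p.
  by rewrite !mulr0 linear0 comp_poly0 mulr0 linear0.
rewrite mulrDr [in RHS]linearD comp_polyD mulrDr linearD hornerD.
rewrite mulrDr linearD hornerD; congr (_ + _).
  have -> : p * (q * 'X) = (p * 'X) * q by ring.
  rewrite IHq; apply/eqP; rewrite -subr_eq0 -hornerN -hornerD -linearB; apply/eqP.
  set F := - (borel ('X * p) * (borel ('X * q) \Po (t%:P - 'X))).
  transitivity ((antideriv (deriv F)).[t]).
    congr ((antideriv _).[t]); rewrite /F derivN derivM deriv_comp !deriv_borelXM.
    rewrite derivB derivX derivC ![_ * 'X]mulrC; ring.
  rewrite antideriv_deriv /F !(hornerN, hornerM, horner_comp, hornerD, hornerC, hornerX).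
  by rewrite subrr !borelXM0 mulr0 mul0r oppr0 subrr.
rewrite /= borelC comp_polyC ![_ * c%:P]mulrC [X in borel X]mulrCA !mul_polyC.
by rewrite !linearZ /= antideriv_borel.
Qed.

Lemma borel_convolution_ge0 p q t : 0 <= t ->
    (forall u, 0 <= u <= t -> 0 <= (borel p).[u]) ->
    (forall u, 0 <= u <= t -> 0 <= (borel q).[u]) ->
  0 <= (borel ('X * (p * q))).[t].
Proof.
move=> t_ge0 p_ge0 q_ge0; rewrite borel_convolution.
have <- : (antideriv (0 : {poly R})).[t] = 0 by rewrite linear0 horner0.
apply: le_antideriv => // u u0t; rewrite horner0 hornerM horner_comp mulr_ge0 ?p_ge0 //.
rewrite q_ge0 // hornerD hornerN hornerC hornerX.
by case/andP: u0t => u_ge0 u_let; rewrite subr_ge0 u_let lerBlDr lerDl.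
Qed.
End Convolution.

(** * The renewal kernel after removal of its exponential part *)

Section Contraction.
Variable R : realType.
Implicit Types (p : {poly R}) (m n j : nat) (t u : R).

Definition inv_borel p : {poly R} := \poly_(k < size p) (p`_k * k`!%:R).

Lemma inv_borelK p : borel (inv_borel p) = p.
Proof.
apply/polyP => k; rewrite coef_borel coef_poly; case: ltnP => [_|le_pk].
  by rewrite mulfK ?fact_natr_neq0.
by rewrite mul0r nth_default.
Qed.

(** A polynomial substitute for the exponential weight e^(-mt/10) on
  [0, 1]. *)
Definition decay_poly m : {poly R} := (1 - 10^-1 *: 'X) ^+ m.

Lemma decay_polyE m t : (decay_poly m).[t] = (1 - t / 10) ^+ m.
Proof. by rewrite horner_exp hornerD hornerN hornerZ hornerC hornerX mulrC. Qed.

(** Its image is the kernel m u (1 - u)^(m-1), see [borel_kernel]. *)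
Definition kernel_poly m : {poly R} := m%:R *: (misspoly R m.-1 - misspoly R m).

Lemma borel_kernel n u :
  (borel (kernel_poly n.+1)).[u] = n.+1%:R * u * (1 - u) ^+ n.
Proof.
rewrite linearZ linearB /= !borel_misspoly hornerZ hornerD hornerN !horner_exp.
by rewrite hornerD hornerN hornerC hornerX exprS; ring.
Qed.

(** Multiplying [misspoly m] by 1 + m z removes from the density its
  exponential part m e^(-mu), whose renewal equation has the solution
  1 + m t. *)
Lemma mulX_kernel m :
  'X * kernel_poly m = 1 - (1 + m%:R *: 'X) * misspoly R m.
Proof.
rewrite /kernel_poly scalerBr mulrBr -hitE -scalerAr mulrDl mul1r -scalerAl.
by rewrite opprD addrA.
Qed.

(** On [0, 1] the weight satisfies
  1 - (t - u)/10 <= (1 - t/10) (1 + u/9), and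
  (1 - u) (1 + u/9) <= 1 - 8u/9.  So the convolution is at most the weight at
  t times (10/9) times the integral of m u (1 - 8u/9)^(m-1), which is at most
  (81/64) / (m+1).  The product of the constants is below 3/4 already for
  m = 1. *)
Lemma kernel_decay m t : (0 < m)%N -> 0 <= t <= 1 ->
  (borel ('X * (kernel_poly m * inv_borel (decay_poly m)))).[t]
  <= 3 / 4 * (decay_poly m).[t].
Proof.
case: m => // n _ t01; have /andP[t_ge0 t_le1] := t01.
set h := (decay_poly n.+1).[t].
have h_ge0 : 0 <= h by rewrite /h decay_polyE exprn_ge0 //; lra.
have [y [yE dy]] : exists y : {poly R},
    (forall u, y.[u] = 1 - 8 / 9 * u) /\ deriv y = (- (8 / 9))%:P.
  exists (1 - (8 / 9) *: 'X); split => [u|].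
    by rewrite hornerD hornerN hornerZ hornerC hornerX.
  by rewrite derivB derivZ derivX derivC sub0r -mul_polyC mulr1 polyCN.
pose C := h * n.+1%:R * (10 / 9) * (81 / 64).
(* With y = 1 - 8u/9, an antiderivative of a multiple of u y^n is found from
   u = (1 - y) * 9 / 8. *)
pose Y := (- C) *: (n.+1%:R^-1 *: y ^+ n.+1 - n.+2%:R^-1 *: y ^+ n.+2).
have dY u : (deriv Y).[u] = h * n.+1%:R * (10 / 9) * (u * (1 - 8 / 9 * u) ^+ n).
  have dyX k : (deriv (y ^+ k.+1)).[u] = (1 - 8 / 9 * u) ^+ k * (- (8 / 9)) * k.+1%:R.
    by rewrite deriv_exp hornerMn -[LHS]mulr_natr hornerM horner_exp
      yE dy hornerC [_ * _ ^+ _]mulrC.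
  rewrite /Y derivZ derivB !derivZ !(hornerZ, hornerD, hornerN) !dyX exprS /C.
  by field; apply/andP; split; apply: lt0r_neq0; rewrite ltr_wpDr.
rewrite borel_convolution inv_borelK.
apply: (@le_trans _ _ (antideriv (deriv Y)).[t]).
  apply: le_antideriv => // u /andP[u_ge0 u_let].
  rewrite dY hornerM horner_comp borel_kernel decay_polyE /h decay_polyE.
  rewrite !(hornerD, hornerN, hornerC, hornerX).
  have step1 : (1 - (t - u) / 10) ^+ n.+1 <= ((1 - t / 10) * (1 + u / 9)) ^+ n.+1.
    by rewrite lerXn2r ?nnegrE //; [lra|nra|nra].
  have step2 : ((1 - u) * (1 + u / 9)) ^+ n <= (1 - 8 / 9 * u) ^+ n.
    by rewrite lerXn2r ?nnegrE //; nra.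
  apply: (@le_trans _ _ (n.+1%:R * u * (1 - u) ^+ n * ((1 - t / 10) * (1 + u / 9)) ^+ n.+1)).
    by rewrite ler_wpM2l // !mulr_ge0 ?exprn_ge0 //; lra.
  have -> : n.+1%:R * u * (1 - u) ^+ n * ((1 - t / 10) * (1 + u / 9)) ^+ n.+1 =
      (1 - t / 10) ^+ n.+1 * n.+1%:R * u * ((1 + u / 9) * ((1 - u) * (1 + u / 9)) ^+ n).
    by rewrite !exprMn [(1 + u / 9) ^+ n.+1]exprS; ring.
  have -> : (1 - t / 10) ^+ n.+1 * n.+1%:R * (10 / 9) * (u * (1 - 8 / 9 * u) ^+ n) =
      (1 - t / 10) ^+ n.+1 * n.+1%:R * u * (10 / 9 * (1 - 8 / 9 * u) ^+ n) by ring.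
  rewrite ler_wpM2l ?mulr_ge0 ?exprn_ge0 //; first lra.
  by rewrite ler_pM ?exprn_ge0 //; [lra|nra|lra].
rewrite antideriv_deriv /Y !(hornerZ, hornerD, hornerN, horner_exp) !yE mulr0 subr0 !expr1n.
set w := 1 - 8 / 9 * t; have w_ge0 : 0 <= w by rewrite /w; lra.
have w_le1 : w <= 1 by rewrite /w; lra.
have C_ge0 : 0 <= C by rewrite /C !mulr_ge0.
set n1 := n.+1%:R; set n2 := n.+2%:R.
have n1_gt0 : 0 < n1 :> R by rewrite ltr0n.
have n2E : n2 = n1 + 1 :> R by rewrite /n2 -natr1.
have n2V_le : n2^-1 <= 1 / 2 :> R.
  by rewrite div1r lef_pV2 ?posrE ?ltr0n // ler_nat.
apply: (@le_trans _ _ (C * (n1^-1 - n2^-1))).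
  rewrite -subr_ge0; have -> : C * (n1^-1 - n2^-1) -
      (- C * (n1^-1 * w ^+ n.+1 - n2^-1 * w ^+ n.+2) - - C * (n1^-1 * 1 - n2^-1 * 1)) =
      C * (w ^+ n.+1 * (n1^-1 - n2^-1 * w)) by rewrite [w ^+ n.+2]exprS; ring.
  rewrite !mulr_ge0 ?exprn_ge0 // subr_ge0.
  rewrite -[leRHS]mulr1 ler_pM ?invr_ge0 ?ler0n //.
  by rewrite lef_pV2 ?posrE ?ltr0n // ler_nat.
have -> : C * (n1^-1 - n2^-1) = h * ((10 / 9) * (81 / 64) * n2^-1).
  rewrite /C -/n1 n2E; field.
  by rewrite !lt0r_neq0 // ltr_wpDr // ltW.
rewrite mulrC ler_wpM2r //; move: (n2^-1) n2V_le => v v_le; lra.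
Qed.

End Contraction.

(** * Exponentially small remainder *)

Section PartB.
Variable R : realType.
Implicit Types (m n j : nat) (t u : R).

(** The slope is the inverse of the mean wait 1 / (m+1); the constant term is
  the second moment of the wait divided by twice the square of its mean, as
  in the renewal theorem. *)
Definition line_poly m : {poly R} := m.+1%:R *: 'X + (m.+1%:R / m.+2%:R)%:P.

Lemma borel_line m t :
  (borel (line_poly m)).[t] = m.+1%:R * t + m.+1%:R / m.+2%:R.
Proof.
by rewrite linearD linearZ /= borelX borelC hornerD hornerZ hornerX hornerC.
Qed.

Definition residual m j : {poly R} := renewal_poly R m j - line_poly m.

(** The defect of the line in the renewal equation, multiplied by
  1 + m z. *)
Definition forcing m : {poly R} :=
  (1 + m%:R *: 'X) * (1 - misspoly R m * line_poly m).

(** One Neumann step of the equation r = g + k * r; the last term measures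
  how far the partial sum is from the fixed point, and tends to 0. *)
Lemma residualS m j :
  residual m j.+1 =
  forcing m + 'X * (kernel_poly R m * residual m j)
    - m%:R *: ('X * (1 - misspoly R m) ^+ j.+1).
Proof.
have VS : renewal_poly R m j.+1 = renewal_poly R m j + (1 - misspoly R m) ^+ j.+1.
  by rewrite /renewal_poly big_ord_recr.
have BV := misspoly_mul_renewal R m j.
rewrite /residual VS /forcing mulrA mulX_kernel -!mul_polyC.
set V := renewal_poly _ _ _ in BV *; set B := misspoly R m in BV *.
set E := (1 - B) ^+ _ in BV *; set a := line_poly m; set M := m%:R%:P.
have -> : E = 1 - B * V by rewrite BV opprB addrC subrK.
ring.
Qed.

Lemma borel_forcing m t :
  (borel (forcing m)).[t] = (1 - t) ^+ m *
    (1 - t - m.+1%:R / m.+2%:R + m%:R / m.+2%:R * (t * (1 - t))).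
Proof.
have n1 : m.+1%:R != 0 :> R by rewrite pnatr_eq0.
have n2 : m.+2%:R != 0 :> R by rewrite pnatr_eq0.
have forcingE : forcing m = misspoly R m.+1 - (m.+1%:R / m.+2%:R) *: misspoly R m
    + (m%:R / m.+2%:R) *: (misspoly R m.+1 - misspoly R m.+2).
  have X0 := mulX_misspoly R m; have X1 := mulX_misspoly R m.+1.
  rewrite /forcing /line_poly.
  set B := misspoly R m in X0 *; set B1 := misspoly R m.+1 in X0 X1 *.
  set B2 := misspoly R m.+2 in X1 *; set c := _ / m.+2%:R.
  have -> : 1 - B * (m.+1%:R *: 'X + c%:P) = B1 - c *: B.
    have -> : B1 = 1 - m.+1%:R *: ('X * B) by rewrite X0 opprB addrC subrK.
    by rewrite -!mul_polyC; ring.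
  rewrite mulrDl mul1r; congr (_ + _).
  have XB1 : 'X * B1 = m.+2%:R^-1 *: (1 - B2) by rewrite -X1 scalerA mulVf ?scale1r.
  have XB : 'X * B = m.+1%:R^-1 *: (1 - B1) by rewrite -X0 scalerA mulVf ?scale1r.
  rewrite -scalerAl mulrBr XB1 -scalerAr XB scalerA /c mulrAC divff // div1r.
  by rewrite -scalerBr opprB addrA addrC [-1 + _]addrC; rewrite scalerA; congr (_ *: _); ring.
set rhs := RHS; rewrite forcingE linearD linearB !linearZ linearB /= !borel_misspoly.
rewrite !(hornerD, hornerN, hornerZ, horner_exp, hornerC, hornerX) !exprS.
by rewrite /rhs; ring.
Qed.

Lemma borel_forcing_le m t : 0 <= t <= 1 ->
  `|(borel (forcing m)).[t]| <= 2 * (decay_poly R m).[t].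
Proof.
move=> /andP[t_ge0 t_le1]; rewrite borel_forcing decay_polyE normrM mulrC.
have ratio_le1 k l : (k <= l)%N -> 0 <= (k%:R / l.+1%:R : R) <= 1.
  move=> le_kl; rewrite divr_ge0 //= ler_pdivrMr ?ltr0n // mul1r ler_nat.
  exact: leqW.
have /andP[c_ge0 c_le1] := ratio_le1 m.+1 m.+1 (leqnn _).
have /andP[d_ge0 d_le1] := ratio_le1 m m.+1 (leqnSn _).
apply: ler_pM => //; last first.
  rewrite normrX ger0_norm ?subr_ge0 // lerXn2r ?nnegrE ?subr_ge0 //; lra.
have tt_ge0 : 0 <= t * (1 - t) by rewrite mulr_ge0 ?subr_ge0.
have tt_le1 : t * (1 - t) <= 1 by nra.
have p_ge0 := mulr_ge0 d_ge0 tt_ge0.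
have p_le1 : m%:R / m.+2%:R * (t * (1 - t)) <= 1 by rewrite -[leRHS]mulr1 ler_pM.
move: (m%:R / m.+2%:R * _) p_ge0 p_le1 => p p_ge0 p_le1.
move: (m.+1%:R / m.+2%:R) c_ge0 c_le1 => c c_ge0 c_le1.
by rewrite ler_norml; apply/andP; split; lra.
Qed.

(** A positive kernel preserves the two-sided bound, and [kernel_decay]
  contracts the weight. *)
Lemma residual_kernel_le m j N t : (0 < m)%N -> 0 <= t <= 1 ->
    (forall u, 0 <= u <= 1 -> `|(borel (residual m j)).[u]| <= N * (decay_poly R m).[u]) ->
  `|(borel ('X * (kernel_poly R m * residual m j))).[t]|
    <= 3 / 4 * N * (decay_poly R m).[t].
Proof.
move=> m_gt0 t01 resid_le; have /andP[t_ge0 t_le1] := t01.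
have decay_gt0 : 0 < (decay_poly R m).[0].
  by rewrite decay_polyE mul0r subr0 expr1n.
have N_ge0 : 0 <= N.
  by rewrite -(pmulr_lge0 _ decay_gt0) (le_trans (normr_ge0 _) (resid_le 0 _)) // lexx ler01.
set H := inv_borel (decay_poly R m).
have kernel_ge0 u : 0 <= u <= t -> 0 <= (borel (kernel_poly R m)).[u].
  move=> /andP[u_ge0 u_let]; case: (m) m_gt0 => // n _.
  by rewrite borel_kernel !mulr_ge0 ?exprn_ge0 // subr_ge0 (le_trans u_let).
(* Used with e = 1 and e = -1. *)
have sub_ge0 (e : R) u : `|e| <= 1 -> 0 <= u <= t ->
    0 <= (borel (N *: H + e *: residual m j)).[u].
  move=> e_le1 /andP[u_ge0 u_let].
  rewrite linearD !linearZ /= inv_borelK hornerD !hornerZ.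
  have u01 : 0 <= u <= 1 by rewrite u_ge0 (le_trans u_let).
  rewrite -lerBlDr sub0r (le_trans _ (resid_le u u01)) //.
  rewrite (le_trans (ler_norm _)) // normrN.
  by rewrite normrM -[leRHS]mul1r ler_wpM2r.
have conv_ge0 (e : R) : `|e| <= 1 ->
    0 <= N * (borel ('X * (kernel_poly R m * H))).[t]
         + e * (borel ('X * (kernel_poly R m * residual m j))).[t].
  move=> e_le1; have := borel_convolution_ge0 t_ge0 kernel_ge0 (fun u => sub_ge0 e u e_le1).
  have -> : 'X * (kernel_poly R m * (N *: H + e *: residual m j)) =
      N *: ('X * (kernel_poly R m * H)) + e *: ('X * (kernel_poly R m * residual m j)).
    by rewrite -!mul_polyC; ring.
  by rewrite linearD !linearZ /= hornerD !hornerZ.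
have upper := kernel_decay m_gt0 t01.
have := conv_ge0 1; rewrite normr1 => /(_ (lexx _)) lo.
have := conv_ge0 (-1); rewrite normrN1 => /(_ (lexx _)) hi.
have := ler_wpM2l N_ge0 upper; rewrite ler_norml -/H => NH; lra.
Qed.

Lemma decay_ge m t : 0 <= t <= 1 -> (9 / 10) ^+ m <= (decay_poly R m).[t].
Proof.
move=> /andP[t_ge0 t_le1]; rewrite decay_polyE lerXn2r ?nnegrE //; lra.
Qed.

(** The constant 8 is the fixed point of x |-> 2 + 3x/4.  The last term of
  [residualS] is of size C^j / j!, which decays faster than any geometric
  sequence; 7/8 is a ratio strictly between 3/4 and 1, so that the excess
  over 8 keeps shrinking. *)
Lemma residual_bound m : (0 < m)%N -> exists D : R, forall j t, 0 <= t <= 1 ->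
  `|(borel (residual m j)).[t]| <= (8 + D * (7 / 8) ^+ j) * (decay_poly R m).[t].
Proof.
move=> m_gt0; pose g : R := (9 / 10) ^+ m.
have g_gt0 : 0 < g by rewrite exprn_gt0.
pose A := hit_bound R m; have A_ge0 : 0 <= A := hit_bound_ge0 R m.
pose D1 := 8 * (m%:R * expR (A * (8 / 7))) / g.
have D1_ge0 : 0 <= D1 by rewrite /D1 divr_ge0 ?(ltW g_gt0) // !mulr_ge0 ?expR_ge0.
pose D2 : R := (m%:R + 3) / g.
have D2_ge0 : 0 <= D2 by rewrite divr_ge0 ?(ltW g_gt0) // addr_ge0.
exists (D1 + D2); elim=> [|j IHj] t t01; have /andP[t_ge0 t_le1] := t01.
  have h_ge := decay_ge m t01; rewrite -/g in h_ge.
  have h_ge0 := le_trans (ltW g_gt0) h_ge.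
  apply: (@le_trans _ _ (D2 * g)); last first.
    by rewrite expr0 mulr1 ler_pM ?(ltW g_gt0) //; lra.
  rewrite /D2 divfK ?lt0r_neq0 // /residual /renewal_poly big_ord1 expr0.
  rewrite linearB /= hornerD hornerN borelC hornerC borel_line.
  have c_ge0 : 0 <= m.+1%:R / m.+2%:R :> R by rewrite divr_ge0.
  have c_le1 : m.+1%:R / m.+2%:R <= 1 :> R.
    by rewrite ler_pdivrMr ?ltr0n // mul1r ler_nat.
  have mt_ge0 : 0 <= m%:R * t by rewrite mulr_ge0.
  have mt_le : m%:R * t <= m%:R by rewrite ler_piMr.
  move: (m.+1%:R / m.+2%:R) c_ge0 c_le1 => c c_ge0 c_le1.
  by rewrite -natr1 mulrDl mul1r ler_norml; apply/andP; split; lra.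
have := residual_kernel_le m_gt0 t01 IHj.
have := borel_forcing_le m t01.
rewrite residualS linearB linearD linearZ /= !(hornerD, hornerN, hornerZ).
have hit_le : `|m%:R * (borel ('X * (1 - misspoly R m) ^+ j.+1)).[t]|
    <= D1 / 8 * (7 / 8) ^+ j * (decay_poly R m).[t].
  have h_ge := decay_ge m t01; rewrite -/g in h_ge.
  apply: (@le_trans _ _ (D1 / 8 * (7 / 8) ^+ j * g)); last first.
    by rewrite ler_wpM2l // mulr_ge0 ?exprn_ge0 // divr_ge0.
  have -> : D1 / 8 * (7 / 8) ^+ j * g = m%:R * (expR (A * (8 / 7)) * (7 / 8) ^+ j).
    by rewrite /D1; field; rewrite lt0r_neq0.
  rewrite normrM ger0_norm // ler_wpM2l //.
  apply: le_trans (borel_mulX_hitX_le m j.+1 t01) _; rewrite -/A.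
  apply: (@le_trans _ _ ((A * (8 / 7)) ^+ j.+1 / j.+1`!%:R * (7 / 8) ^+ j.+1)).
    rewrite mulrAC -exprMn; have -> : A * (8 / 7) * (7 / 8) = A by field.
    rewrite ler_wpM2l ?exprn_ge0 // lef_pV2 ?posrE ?ltr0n ?fact_gt0 //.
    by rewrite ler_nat leq_fact.
  apply: ler_pM.
  - by rewrite divr_ge0 ?exprn_ge0 // mulr_ge0.
  - by rewrite exprn_ge0.
  - have A'_ge0 : 0 <= A * (8 / 7) by rewrite mulr_ge0.
    apply: le_trans (sum_exp_le_expR j.+2 A'_ge0).
    rewrite big_ord_recr /= lerDr sumr_ge0 // => i _.
    by rewrite divr_ge0 ?exprn_ge0.
  - by rewrite exprS ler_piMl ?exprn_ge0 //; lra.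
set h := (decay_poly R m).[t] in hit_le *.
have D2q : 0 <= D2 * (7 / 8) ^+ j * h.
  have h_ge0 : 0 <= h := le_trans (ltW g_gt0) (decay_ge m t01).
  by apply: mulr_ge0 => //; rewrite mulr_ge0 ?exprn_ge0.
move=> f_le k_le; rewrite (le_trans (ler_normB _ _)) //.
rewrite (le_trans (lerD (ler_normD _ _) (lexx _))) //.
apply: (le_trans (lerD (lerD f_le k_le) hit_le)).
have -> : (8 + (D1 + D2) * (7 / 8) ^+ j.+1) * h =
  8 * h + 7 / 8 * (D1 * (7 / 8) ^+ j * h) + 7 / 8 * (D2 * (7 / 8) ^+ j * h).
  by rewrite exprS; ring.
have -> : 2 * h + 3 / 4 * (8 + (D1 + D2) * (7 / 8) ^+ j) * h + D1 / 8 * (7 / 8) ^+ j * h =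
  8 * h + 7 / 8 * (D1 * (7 / 8) ^+ j * h) + 3 / 4 * (D2 * (7 / 8) ^+ j * h) by field.
lra.
Qed.

Theorem limL1_asymptotics m : (0 < m)%N ->
  `|limL1 R m - (m%:R + 1 - (m%:R + 2)^-1)| <= 8 * expR (- (10^-1 * m%:R)).
Proof.
move=> m_gt0; have [D residual_le] := residual_bound m_gt0.
set L := m%:R + 1 - _.
have mean_le n : `|meanL1 R m n - L| <= (8 + D * (7 / 8) ^+ n) * (9 / 10) ^+ m.
  have := residual_le n 1; rewrite ler01 lexx => /(_ isT).
  rewrite decay_polyE mul1r (_ : 1 - 10^-1 = 9 / 10); last by lra.
  congr (`|_| <= _); rewrite meanL1_renewal /residual linearB hornerD hornerN /borel_at1.
  rewrite borel_line mulr1 /L.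
  have := ltr0Sn R m.+1; rewrite -!natr1 => m2_gt0; field.
  by rewrite lt0r_neq0 //; lra.
have rate_le : (9 / 10) ^+ m <= expR (- (10^-1 * m%:R)) :> R.
  rewrite -mulNr [- 10^-1 * _]mulrC expRM_natl lerXn2r ?nnegrE ?expR_ge0 //.
  by apply: le_trans (expR_ge1Dx _); lra.
apply: (@le_trans _ _ (8 * (9 / 10) ^+ m)); last by rewrite ler_wpM2l.
have cvL : meanL1 R m n @[n --> \oo] --> limL1 R m := @is_cvg_meanL1 R m.
have cvg_mean : `|meanL1 R m n - L| @[n --> \oo] --> `|limL1 R m - L|.
  exact: (cvg_norm (cvgB cvL (cvg_cst L))).
have cvg_bound : (8 + D * (7 / 8) ^+ n) * (9 / 10) ^+ m @[n --> \oo]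
    --> (8 * (9 / 10) ^+ m : R).
  apply: cvgMr_tmp; rewrite -[X in _ --> X]addr0.
  have q_lt1 : `|7 / 8 : R| < 1 by rewrite ger0_norm; lra.
  exact: cvgD (cvg_cst _) (cvg_geometric D q_lt1).
by apply: (ler_cvg_to cvg_mean cvg_bound); apply: nearW.
Qed.

End PartB.

Theorem theorem1p1 (R : realType) :
  (forall (m : nat) (alpha : m.-tuple R[i]),
     (1 <= m)%N -> zeroes_of (truncexp R m) alpha ->
     cvgn (meanL1 R m) /\
     (limL1 R m)%:C =
       - 1 - \sum_(i < m) (tnth alpha i)^-1 * expC (- tnth alpha i)) /\
  (exists beta K : R, 0 < beta /\ 0 < K /\
     forall m : nat, (1 <= m)%N ->
       `|limL1 R m - (m%:R + 1 - (m%:R + 2)^-1)| <= K * expR (- (beta * m%:R))).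
Proof.
split=> [m alpha m_gt0 zeroes_alpha|].
  by split; [exact: is_cvg_meanL1|exact: limL1_zeroes].
exists 10^-1, 8; split; first by rewrite invr_gt0.
by split=> // m; apply: limL1_asymptotics.
Qed.
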